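(* Let $d\in\{2,3\}$, let $U$ be either the cube $I^d$ or the simplex $\Delta^d$, let $p\ge 1$ be an integer, and let $F:U\to\mathbb{R}^d$ be a polynomial function of degree at most $p$ (degree at most $p$ in each individual coordinate if $U=I^d$, total degree at most $p$ if $U=\Delta^d$). Let $G_\xi,G_\eta$ (and $G_\zeta$ if $d=3$) be the lists of Bernstein-Bézier control points of the partial derivatives of $F$. Assume that: if $d=2$, the matrix $[\mathbf{u},\mathbf{v}]$ with columns $\mathbf{u},\mathbf{v}$ is invertible for every $\mathbf{u}\in\operatorname{hull}(G_\xi)$ and every $\mathbf{v}\in\operatorname{hull}(G_\eta)$; if $d=3$, the matrix $[\mathbf{u},\mathbf{v},\mathbf{w}]$ is invertible for every $\mathbf{u}\in\operatorname{hull}(G_\xi)$, $\mathbf{v}\in\operatorname{hull}(G_\eta)$, $\mathbf{w}\in\operatorname{hull}(G_\zeta)$. Then the derivative matrix $J(\mathbf{x})$ of $F$ is invertible at every $\mathbf{x}\in U$.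
   Context: $\operatorname{hull}$ denotes convex hull. $I^d=[0,1]^d$; $\Delta^2=\{(\xi,\eta):\xi,\eta\ge 0,\ \xi+\eta\le 1\}$; $\Delta^3=\{(\xi,\eta,\zeta):\xi,\eta,\zeta\ge 0,\ \xi+\eta+\zeta\le 1\}$. $J$ is the $d\times d$ matrix of $F$ whose columns are the partial derivatives $\partial F/\partial\xi,\partial F/\partial\eta$ (and $\partial F/\partial\zeta$ if $d=3$). Bernstein-Bézier (BB) form: $F$ is written uniquely with control points $\mathbf{f}_{i,j}\in\mathbb{R}^2$ or $\mathbf{f}_{i,j,k}\in\mathbb{R}^3$ as follows. On $I^2$: $F(\xi,\eta)=\sum_{i=0}^p\sum_{j=0}^p \mathbf{f}_{i,j}\binom{p}{i}\binom{p}{j}(1-\xi)^{p-i}\xi^i(1-\eta)^{p-j}\eta^j$. On $I^3$: $F(\xi,\eta,\zeta)=\sum_{i,j,k=0}^p \mathbf{f}_{i,j,k}\binom{p}{i}\binom{p}{j}\binom{p}{k}(1-\xi)^{p-i}\xi^i(1-\eta)^{p-j}\eta^j(1-\zeta)^{p-k}\zeta^k$. On $\Delta^2$: $F(\xi,\eta)=\sum_{i,j\ge 0,\,i+j\le p}\mathbf{f}_{i,j}\frac{p!}{i!\,j!\,(p-i-j)!}\xi^i\eta^j(1-\xi-\eta)^{p-i-j}$. On $\Delta^3$: $F(\xi,\eta,\zeta)=\sum_{i,j,k\ge 0,\,i+j+k\le p}\mathbf{f}_{i,j,k}\frac{p!}{i!\,j!\,k!\,(p-i-j-k)!}\xi^i\eta^j\zeta^k(1-\xi-\eta-\zeta)^{p-i-j-k}$.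 $G_\xi$ is the finite list of all vectors $p(\mathbf{f}_{i+1,j}-\mathbf{f}_{i,j})$ (for $d=2$) or $p(\mathbf{f}_{i+1,j,k}-\mathbf{f}_{i,j,k})$ (for $d=3$), over all indices for which both control points are defined; these are the BB control points of $\partial F/\partial\xi$. Similarly $G_\eta$ consists of all vectors $p(\mathbf{f}_{i,j+1}-\mathbf{f}_{i,j})$ or $p(\mathbf{f}_{i,j+1,k}-\mathbf{f}_{i,j,k})$, and, for $d=3$, $G_\zeta$ consists of all vectors $p(\mathbf{f}_{i,j,k+1}-\mathbf{f}_{i,j,k})$. *)

(* Defs.v *)
From mathcomp Require Import all_boot all_order all_algebra.
From mathcomp Require Import boolp classical_sets reals topology normedtype.
From mathcomp Require Import convex derive.
(* The notations of [mpoly] clash with those of the analysis library. *)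
From mathcomp Require mpoly.
Import (canonicals, coercions) mpoly.

Set Implicit Arguments.
Unset Strict Implicit.
Unset Printing Implicit Defensive.

Import Order.TTheory GRing.Theory Num.Theory.
Import numFieldNormedType.Exports.

Local Open Scope classical_set_scope.
Local Open Scope ring_scope.

Inductive domain_shape := Cube | Simplex.

Section Domain.
Context {R : realType} (d : nat).

Definition domain_set (U : domain_shape) : set 'cV[R]_d :=
  match U with
  | Cube => [set x | forall l, 0 <= x l 0 <= 1]
  | Simplex => [set x | (forall l, 0 <= x l 0) /\ \sum_l x l 0 <= 1]
  end.

(* A polynomial function on a domain is identified with its unique polynomial
   extension to the whole space, so that its partial derivatives make sense at
   boundary points as well.  Note that [msize] is the total degree plus one. *)
Definition degree_le (U : domain_shape) (p : nat) (P : mpoly.mpoly d R) :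
    Prop :=
  match U with
  | Cube => forall m, m \in mpoly.msupp P -> forall l : 'I_d, (m l <= p)%N
  | Simplex => (mpoly.msize P <= p.+1)%N
  end.

Definition polynomial_map (U : domain_shape) (p : nat)
    (F : 'cV[R]_d -> 'cV[R]_d) :
    Prop :=
  exists P : 'I_d -> mpoly.mpoly d R,
    (forall i, degree_le U p (P i)) /\
    (forall x i, F x i 0 = mpoly.meval (fun l => x l 0) (P i)).

End Domain.

Section ControlPoints.
Context {R : realType} (d : nat) (U : domain_shape) (p : nat).

Local Notation multi_index := {ffun 'I_d -> 'I_p.+1}.

Definition bb_index : {set multi_index} :=
  match U with
  | Cube => [set: multi_index]
  | Simplex => [set m : multi_index | (\sum_l m l <= p)%N]
  end.

Definition bernstein (m : multi_index) (x : 'cV[R]_d) : R :=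
  match U with
  | Cube =>
      \prod_l ('C(p, m l)%:R * (1 - x l 0) ^+ (p - m l) * x l 0 ^+ m l)
  | Simplex =>
      p`!%:R / ((\prod_l (m l)`!) * (p - \sum_l m l)`!)%N%:R
      * \prod_l x l 0 ^+ m l
      * (1 - \sum_l x l 0) ^+ (p - \sum_l m l)
  end.

Definition bb_form (f : multi_index -> 'cV[R]_d) (x : 'cV[R]_d) : 'cV[R]_d :=
  \sum_(m in bb_index) bernstein m x *: f m.

(* The control points of [F].  They exist and are unique on [bb_index] when [F]
   satisfies [polynomial_map U p]; values outside [bb_index] are arbitrary and
   are never used below. *)
Definition control_points (F : 'cV[R]_d -> 'cV[R]_d) :
    multi_index -> 'cV[R]_d :=
  xget (fun=> 0) [set f | forall x, F x = bb_form f x].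

(* [index_succ l m m'] says that m' = m + e_l. *)
Definition index_succ (l : 'I_d) (m m' : multi_index) : bool :=
  [forall k, m' k == (m k + (k == l))%N :> nat].

Definition partial_control_points (F : 'cV[R]_d -> 'cV[R]_d) (l : 'I_d) :
    seq 'cV[R]_d :=
  [seq p%:R *: (control_points F mm.2 - control_points F mm.1)
     | mm : multi_index * multi_index
       in [pred mm | [&& mm.1 \in bb_index, mm.2 \in bb_index
                       & index_succ l mm.1 mm.2]]].

End ControlPoints.

Definition hull {R : realType} {E : lmodType R} (s : seq E) : set E :=
  smallest (@convex_set R E) [set` s].

Definition of_columns {R : realType} {d : nat} (u : 'I_d -> 'cV[R]_d) :
    'M[R]_d :=
  \matrix_(i, j) u j i 0.

(* The library's ['J] acts on row vectors and is the transpose of this. *)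
Definition derivative_matrix {R : realType} {d : nat}
    (F : 'cV[R]_d -> 'cV[R]_d) (x : 'cV[R]_d) : 'M[R]_d :=
  of_columns (fun l => 'D_(delta_mx l 0) F x).

(* Main.v *)
Require Import Defs.
From mathcomp Require Import all_boot all_order all_algebra.
From mathcomp Require Import boolp classical_sets reals topology normedtype.
From mathcomp Require Import convex derive.
From mathcomp Require Import ring.
From mathcomp Require mpoly.
Import (canonicals, coercions) mpoly.
Import Order.TTheory GRing.Theory Num.Theory.
Import numFieldNormedType.Exports.
Local Open Scope classical_set_scope.
Local Open Scope ring_scope.

Set Implicit Arguments.
Unset Strict Implicit.
Unset Printing Implicit Defensive.

(* Each column D_l F(x) is a nonnegative combination of the control points
   p (f_(m + e_l) - f_m) of the l-th partial derivative, with some positive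
   coefficient: along the line x + R e_l every Bernstein polynomial has, for the
   cube as for the simplex, the form C (s + h)^i (r - h)^e, and its two
   derivative terms telescope over the pairs (m, m + e_l).  So D_l F(x) is a
   positive multiple of a point of the hull, and the determinant of the
   derivative matrix is a positive multiple of one that the hypothesis makes
   nonzero; the partition of unity is never needed. *)

(** * Convex hulls and normalised nonnegative combinations *)

Section Hull.
Context {R : realType} {E : lmodType R}.
Implicit Types (s : seq E) (u v : E).

Lemma hull_mem s v : v \in s -> hull s v.
Proof. by move=> sv A [_]; apply. Qed.

Lemma hull_conv s u v (a b : R) : 0 <= a -> 0 <= b -> a + b = 1 ->
  hull s u -> hull s v -> hull s (a *: u + b *: v).
Proof.
move=> a0 b0 ab su sv A [cA sA].
have a1 : a <= 1 by rewrite -ab lerDl.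
have := cA u v (interval_inference.Itv01 a0 a1).
rewrite !inE => /(_ (su _ (conj cA sA)) (sv _ (conj cA sA))).
by rewrite (_ : b = 1 - a)// -ab addrAC subrr add0r.
Qed.

(** Adding a term of weight [w i] to a sum [T] of total weight [S] turns [S^-1 *: T] into its convex
    combination with [v i], with weights [S / (w i + S)] and [w i / (w i + S)]. *)
Lemma hull_barycenter s (I : finType) (P : pred I) (w : I -> R) (v : I -> E) :
  (forall i, P i -> 0 <= w i) -> (forall i, P i -> hull s (v i)) ->
  0 < \sum_(i | P i) w i ->
  hull s ((\sum_(i | P i) w i)^-1 *: \sum_(i | P i) w i *: v i).
Proof.
move=> w0 sv.
(* Partial sums may have total weight zero and then cannot be normalised, so the induction also
   carries the case where weight and vector sum both vanish. *)
suff : \sum_(i | P i) w i = 0 /\ \sum_(i | P i) w i *: v i = 0 \/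
    0 < \sum_(i | P i) w i /\
    hull s ((\sum_(i | P i) w i)^-1 *: \sum_(i | P i) w i *: v i).
  by move=> [[->]|[]//]; rewrite ltxx.
elim/big_rec2 : _ => [|i T S Pi ih]; first by left.
have := w0 i Pi; rewrite le_eqVlt => /predU1P[<-|wi0].
  by rewrite !add0r scale0r add0r.
right; case: ih => [[-> ->]|[S0 hT]].
  by rewrite !addr0 scalerA mulVf ?gt_eqF// scale1r; split=> //; exact: sv.
have wS0 : 0 < w i + S by rewrite addr_gt0.
split=> //.
have -> : (w i + S)^-1 *: (w i *: v i + T) =
    (w i / (w i + S)) *: v i + (S / (w i + S)) *: (S^-1 *: T).
  rewrite scalerDr !scalerA mulrC; congr (_ + _ *: _).
  by rewrite mulrAC divff ?gt_eqF// mul1r.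
apply: hull_conv => //; last exact: sv.
- by rewrite divr_ge0// ltW.
- by rewrite divr_ge0// ltW.
- by rewrite -mulrDl divff ?gt_eqF.
Qed.

End Hull.

(** The vectors [f i] do not depend on [h], so the difference quotient of [F] splits into difference
    quotients of the real polynomials [Phi i], whose limits at 0 are known. *)
Lemma derive_poly_combination (R : realType) (V W : normedModType R)
    (I : finType) (P : pred I) (Phi : I -> {poly R}) (f : I -> W)
    (F : V -> W) (x v : V) :
  (forall h : R, F (h *: v + x) = \sum_(i | P i) (Phi i).[h] *: f i) ->
  'D_v F x = \sum_(i | P i) (Phi i)^`().[0] *: f i.
Proof.
move=> FE; apply: cvg_lim => //=.
have -> : (fun h : R => h^-1 *: (F (h *: v + x) - F x)) =
    (fun h : R => \sum_(i | P i) (h^-1 * ((Phi i).[h] - (Phi i).[0])) *: f i).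
  apply/funext => h; have := FE 0; rewrite scale0r add0r => ->.
  rewrite FE -sumrB scaler_sumr; apply: eq_bigr => i _.
  by rewrite -scalerBl scalerA.
apply: cvg_big => [|i _]; first exact: add_continuous.
apply: cvgZr_tmp.
have [+ <-] := @is_derive_poly R (Phi i) 0; rewrite /derivable /derive.
rewrite (_ : (fun h => h^-1 *: _) =
  fun h => h^-1 * ((Phi i).[h] - (Phi i).[0]))//.
by apply/funext => h; rewrite /= addr0 scaler1.
Qed.

(** * Bernstein polynomials and their derivatives along a coordinate line *)

Section Line.
Context {R : realType} {d p : nat}.
Variables (U : domain_shape) (l : 'I_d).
Local Notation multi_index := {ffun 'I_d -> 'I_p.+1}.
Implicit Types (m : multi_index) (x : 'cV[R]_d).

Lemma prod_delta (y : 'I_d -> R) : \prod_k y k ^+ (k == l) = y l.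
Proof.
by rewrite (bigD1 l)//= eqxx big1 ?mulr1// => k /negPf->.
Qed.

Lemma sum_delta (a : 'I_d -> nat) :
  (\sum_k (a k + (k == l)) = (\sum_k a k).+1)%N.
Proof.
rewrite big_split/= -addn1; congr (_ + _)%N.
by rewrite (bigD1 l)//= eqxx big1// => k /negPf->.
Qed.

(* Along the line x + R e_l, each Bernstein polynomial is
   [line_coef m x * (x_l + h) ^+ m_l * (line_rest x - h) ^+ line_codeg m]. *)
Definition line_coef m x : R :=
  match U with
  | Cube => 'C(p, m l)%:R *
      \prod_(k | k != l)
        ('C(p, m k)%:R * (1 - x k 0) ^+ (p - m k) * x k 0 ^+ m k)
  | Simplex => p`!%:R / ((\prod_k (m k)`!) * (p - \sum_k m k)`!)%N%:R *
      \prod_(k | k != l) x k 0 ^+ m k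
  end.

Definition line_rest x : R :=
  match U with Cube => 1 - x l 0 | Simplex => 1 - \sum_k x k 0 end.

Definition line_codeg m : nat :=
  match U with Cube => p - m l | Simplex => p - \sum_k m k end.

Lemma bernstein_line m x (h : R) :
  bernstein U m (h *: delta_mx l 0 + x) =
  line_coef m x * (x l 0 + h) ^+ m l * (line_rest x - h) ^+ line_codeg m.
Proof.
have xl : (h *: delta_mx l 0 + x) l 0 = x l 0 + h.
  by rewrite !mxE !eqxx mulr1 addrC.
have xk k : k != l -> (h *: delta_mx l 0 + x) k 0 = x k 0.
  by move=> /negPf kl; rewrite !mxE kl mulr0 add0r.
rewrite /bernstein /line_coef /line_rest /line_codeg; case: U.
- rewrite (bigD1 l)//= xl; under eq_bigr => k kl do rewrite xk//.
  by rewrite opprD addrA; ring.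
- have xs : \sum_k (h *: delta_mx l 0 + x) k 0 = \sum_k x k 0 + h.
    rewrite (bigD1 l)//= xl [in RHS](bigD1 l)//= addrAC; congr (_ + _ + _).
    exact: eq_bigr.
  rewrite xs [X in _ * X * _](bigD1 l)//= xl.
  under [X in _ * (_ * X)]eq_bigr => k kl do rewrite xk//.
  by rewrite opprD addrA; ring.
Qed.

(** Boundary values: if m_l = p, [inord] sends the l-th entry of [raise m] to 0; if m_l = 0,
    truncated subtraction gives [lower m = m]. Neither yields an [index_succ] pair, so [succ_pair]
    excludes both. *)
Definition raise m : multi_index := [ffun k => inord (m k + (k == l))].
Definition lower m : multi_index := [ffun k => inord (m k - (k == l))].

Lemma raiseE m k :
  (m k + (k == l) <= p)%N -> raise m k = (m k + (k == l))%N :> nat.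
Proof. by move=> ?; rewrite ffunE inordK. Qed.

Lemma lowerE m k : lower m k = (m k - (k == l))%N :> nat.
Proof. by rewrite ffunE inordK// ltnS (leq_trans (leq_subr _ _))// -ltnS. Qed.

Lemma index_succP m m' :
  reflect (forall k, m' k = (m k + (k == l))%N :> nat) (index_succ l m m').
Proof. by apply: (iffP forallP) => H k; apply/eqP. Qed.

Lemma index_succ_raise m m' : index_succ l m m' -> raise m = m'.
Proof.
move=> /index_succP s; apply/ffunP => k; apply/val_inj => /=.
by rewrite raiseE -s// -ltnS.
Qed.

Lemma index_succ_lower m m' : index_succ l m m' -> lower m' = m.
Proof.
move=> /index_succP s; apply/ffunP => k; apply/val_inj => /=.
by rewrite lowerE s addnK.
Qed.

Definition succ_pair : pred (multi_index * multi_index) :=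
  [pred mm | [&& mm.1 \in bb_index d U p, mm.2 \in bb_index d U p
                & index_succ l mm.1 mm.2]].

Lemma succ_pair_codeg m m' :
  succ_pair (m, m') -> line_codeg m = (line_codeg m').+1.
Proof.
move=> /and3P[/= _ + /index_succP s]; rewrite /line_codeg; case: U => /=.
  move=> _; rewrite s eqxx addn1 subnSK// -ltnS.
  by have := ltn_ord (m' l); rewrite s eqxx addn1.
rewrite inE; under eq_bigr do rewrite s.
by rewrite sum_delta => ?; rewrite subnSK.
Qed.

Lemma succ_pair_raise m :
  succ_pair (m, raise m) = (m \in bb_index d U p) && (0 < line_codeg m)%N.
Proof.
apply/idP/idP => [s|/andP[mU]].
  by rewrite (succ_pair_codeg s); case/and3P: s => /= ->.
(* Positive codegree forces m_l < p; for the simplex this is m_l <= |m| < p. *)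
move=> m0; have le k : (m k + (k == l) <= p)%N.
  have [->|_] := eqVneq; last by rewrite addn0 -ltnS.
  move: m0; rewrite /line_codeg addn1; case: U; rewrite subn_gt0//.
  by apply: leq_ltn_trans; rewrite (bigD1 l)//= leq_addr.
apply/and3P; split=> //=; last by apply/index_succP => k; rewrite raiseE.
move: mU m0; rewrite /bb_index /line_codeg; case: U; rewrite !inE// subn_gt0.
by move=> _ m0; under eq_bigr do rewrite raiseE//; rewrite sum_delta.
Qed.

Lemma succ_pair_lower m :
  succ_pair (lower m, m) = (m \in bb_index d U p) && (0 < m l)%N.
Proof.
apply/idP/idP => [/and3P[/= _ -> /index_succP->]|/andP[mU m0]].
  by rewrite eqxx addn1.
have s k : m k = (lower m k + (k == l))%N :> nat.
  by rewrite lowerE subnK//; have [->|] := eqVneq.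
apply/and3P; split=> //=; last exact/index_succP.
move: mU; rewrite /bb_index; case: U; rewrite !inE//.
by under eq_bigr do rewrite s; rewrite sum_delta => /ltnW.
Qed.

(** This makes the two derivative terms attached to a pair (m, m + e_l) carry the same weight. For
    the cube it is (i + 1) C(p, i + 1) = (p - i) C(p, i) with i = m_l; for the simplex, one factor
    moves between the factorials of m_l and of p - |m|. *)
Lemma line_coef_succ m m' x : succ_pair (m, m') ->
  line_coef m' x * (m' l)%:R = line_coef m x * (line_codeg m)%:R.
Proof.
move=> mm; have := succ_pair_codeg mm.
case/and3P: mm => /= mU m'U /index_succP s.
have sk k : k != l -> m' k = m k.
  by move=> kl; apply/val_inj; rewrite /= s (negPf kl) addn0.
have sl : m' l = (m l).+1 :> nat by rewrite s eqxx addn1.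
rewrite /line_coef /line_codeg; case: U => /= e.
  under eq_bigr => k kl do rewrite sk//.
  rewrite mulrAC [RHS]mulrAC; congr (_ * _); rewrite -!natrM sl; congr _%:R.
  by rewrite mulnC mul_bin_left mulnC.
under [X in _ * X * _ = _]eq_bigr => k kl do rewrite sk//.
rewrite mulrAC [RHS]mulrAC; congr (_ * _).
rewrite -!mulrA; congr (_ * _).
rewrite e (bigD1 l)//= [in RHS](bigD1 l)//= sl !factS.
under eq_bigr => k kl do rewrite sk//.
rewrite !natrM; field.
rewrite !nat1r !pnatr_eq0 -!lt0n !fact_gt0 prodn_gt0// => k.
exact: fact_gt0.
Qed.

(** This is p times the Bernstein polynomial of the l-th partial derivative at index m, of degree p
    - 1 in x_l for the cube and of total degree p - 1 for the simplex; it is 0 when the codegree is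
    0. *)
Definition line_weight m x : R :=
  line_coef m x * (line_codeg m)%:R * x l 0 ^+ m l
  * line_rest x ^+ (line_codeg m).-1.

Lemma derive_bb_form (f : multi_index -> 'cV[R]_d) x :
  'D_(delta_mx l 0) (bb_form U f) x =
  \sum_(mm | succ_pair mm) line_weight mm.1 x *: (f mm.2 - f mm.1).
Proof.
pose Phi m : {poly R} := (line_coef m x)%:P * ('X + (x l 0)%:P) ^+ m l *
  ((line_rest x)%:P - 'X) ^+ line_codeg m.
rewrite (@derive_poly_combination R _ _ _ (mem (bb_index d U p)) Phi f); last first.
  move=> h; apply: eq_bigr => m _; rewrite bernstein_line; congr (_ *: _).
  by rewrite /Phi !hornerE addrC.
(* [up m] comes from differentiating the factor (x_l + h)^(m_l); the other factor contributes
   [- line_weight m x]. *)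
pose up m := line_coef m x * (m l)%:R * x l 0 ^+ (m l).-1
  * line_rest x ^+ line_codeg m.
have -> : \sum_(m in bb_index d U p) (Phi m)^`().[0] *: f m =
    \sum_(m in bb_index d U p) up m *: f m -
    \sum_(m in bb_index d U p) line_weight m x *: f m.
  rewrite -sumrB; apply: eq_bigr => m _; rewrite -scalerBl; congr (_ *: _).
  rewrite /Phi !derivM derivC !deriv_exp !derivD !derivN !derivX !derivC.
  by rewrite /up /line_weight !(hornerE, hornerMn) subr0; ring.
under [RHS]eq_bigr do rewrite scalerBr.
rewrite sumrB; congr (_ - _).
  (* Pairs are indexed here by their upper member; the indices with m_l = 0, which have no
     predecessor, satisfy [up m = 0]. *)
  rewrite (reindex_onto (fun m => (lower m, m)) snd)/=; last first.
    by move=> [m m'] /and3P[/= _ _ /index_succ_lower ->].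
  rewrite (bigID (fun m => 0 < m l)%N)/= [X in _ + X]big1 ?addr0; last first.
    move=> m /andP[_]; rewrite -eqn0Ngt => /eqP m0.
    by rewrite /up m0 mulr0 !mul0r scale0r.
  apply: eq_big => [m|m ml]; first by rewrite eqxx andbT succ_pair_lower.
  congr (_ *: _); move: ml; rewrite -succ_pair_lower => mm.
  rewrite /up /line_weight -(line_coef_succ x mm) (succ_pair_codeg mm)/=.
  by rewrite lowerE eqxx subn1.
(* Now pairs are indexed by their lower member; indices of codegree 0 have weight 0. *)
rewrite (reindex_onto (fun m => (m, raise m)) fst)/=; last first.
  by move=> [m m'] /and3P[/= _ _ /index_succ_raise ->].
rewrite (bigID (fun m => 0 < line_codeg m)%N)/= [X in _ + X]big1 ?addr0; last first.
  move=> m /andP[_]; rewrite -eqn0Ngt => /eqP m0.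
  by rewrite /line_weight m0 mulr0 !mul0r scale0r.
by apply: eq_bigl => m; rewrite eqxx andbT succ_pair_raise.
Qed.

Lemma line_weight_ge0 m x : domain_set U x -> 0 <= line_weight m x.
Proof.
move=> xU.
have [x0 r0 c0] : [/\ 0 <= x l 0, 0 <= line_rest x & 0 <= line_coef m x].
  move: xU; rewrite /line_rest /line_coef; case: U => /= [xU|[xU sx]].
    have x1 k : 0 <= 1 - x k 0 by rewrite subr_ge0; case/andP: (xU k).
    have x0 k : 0 <= x k 0 by case/andP: (xU k).
    split=> //; rewrite mulr_ge0//; apply: prodr_ge0 => k _.
    by rewrite !mulr_ge0 ?exprn_ge0.
  split=> //; first by rewrite subr_ge0.
  by rewrite mulr_ge0 ?divr_ge0//; apply: prodr_ge0 => k _; rewrite exprn_ge0.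
by rewrite /line_weight !mulr_ge0 ?exprn_ge0.
Qed.

(** Even at a boundary point some index avoids every vanishing factor: exponents go on nonzero
    coordinates, and the codegree is 1 wherever [line_rest] might be 0, so that it occurs to the
    power 0. *)
Lemma line_weight_gt0 x : (0 < p)%N -> domain_set U x ->
  exists2 mm, succ_pair mm & 0 < line_weight mm.1 x.
Proof.
move=> p0 xU.
suff [m [mU cg0 c0 x0 r0]] : exists m, [/\ m \in bb_index d U p,
    (0 < line_codeg m)%N, 0 < line_coef m x, 0 < x l 0 ^+ m l
    & 0 < line_rest x ^+ (line_codeg m).-1].
  exists (m, raise m); first by rewrite succ_pair_raise mU cg0.
  by rewrite /line_weight !mulr_gt0// ltr0n.
have ltp : (p.-1 < p)%N by rewrite ltn_predL.
have pp : (p - p.-1 = 1)%N by rewrite -[in LHS](prednK p0) subSnn.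
move: xU; rewrite /line_codeg /line_rest /line_coef; case: U => /= [xU|[xU sx]].
  have x0 k : x k 0 != 0 -> 0 < x k 0.
    by rewrite lt_neqAle eq_sym => ->; case/andP: (xU k).
  (* Coordinates equal to 0 use (1 - x_k)^p, the others x_k^p. If x_l is nonzero, exponent p - 1 at
     l leaves codegree 1; otherwise [line_rest x] is 1. *)
  exists [ffun k =>
    inord (if x k 0 == 0 then 0 else if k == l then p.-1 else p)].
  rewrite inE ffunE inordK ?eqxx; last by case: ifP => // _; rewrite ltnW.
  split=> //.
  - by case: ifP => _; rewrite ?subn0// subn_gt0.
  - rewrite mulr_gt0 ?ltr0n ?bin_gt0//; first by case: ifP => // _; exact: ltnW.
    apply: prodr_gt0 => k /negPf kl; rewrite ffunE kl.
    rewrite inordK; last by case: ifP.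
    rewrite !mulr_gt0 ?ltr0n ?bin_gt0//.
    + by case: ifP.
    + by have [->|_] := eqVneq; rewrite ?subr0 ?expr1n// subnn.
    + by have [//|/x0/exprn_gt0] := eqVneq; exact.
  - by have [//|/x0/exprn_gt0] := eqVneq; exact.
  - have [->|_] := eqVneq; first by rewrite subr0 expr1n.
    by rewrite pp.
have [k xk|x0] := pickP (fun k => x k 0 != 0).
  have xk0 : 0 < x k 0 by rewrite lt_neqAle eq_sym xk xU.
  (* Here m = (p - 1) e_k has codegree 1 and involves only the positive coordinate x_k. *)
  pose m : multi_index := [ffun j => inord (p.-1 * (j == k))].
  have mE j : m j = (p.-1 * (j == k))%N :> nat.
    by rewrite ffunE inordK// ltnS; case: eqP => _; rewrite ?muln0// muln1 ltnW.
  have xm j : 0 < x j 0 ^+ m j.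
    by rewrite mE; have [->|_] := eqVneq; [exact: exprn_gt0|rewrite muln0].
  have sm : (\sum_j m j = p.-1)%N.
    under eq_bigr do rewrite mE.
    by rewrite -big_distrr/= -big_mkcond big_pred1_eq muln1.
  exists m; rewrite inE sm pp expr0 xm ltnW//; split=> //.
  rewrite mulr_gt0 ?prodr_gt0// divr_gt0 ?ltr0n ?muln_gt0 ?fact_gt0 ?prodn_gt0// => j.
  exact: fact_gt0.
(* At the origin m = 0 works, since [line_rest x] is 1. *)
pose m : multi_index := [ffun=> ord0].
have sm : (\sum_j m j = 0)%N by apply: big1 => j _; rewrite ffunE.
have x0' j : x j 0 = 0 by apply/eqP/negbFE/x0.
exists m; rewrite inE sm subn0 ffunE expr0 [\sum_k x k 0]big1// subr0 expr1n.
split=> //.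
rewrite mulr_gt0 ?divr_gt0 ?ltr0n ?muln_gt0 ?fact_gt0 ?prodn_gt0//.
  by move=> j; exact: fact_gt0.
by apply: prodr_gt0 => j _; rewrite ffunE.
Qed.

End Line.


(** * Existence of the Bernstein-Bézier form *)

Section Span.
Context {R : realType} {d p : nat}.
Variable U : domain_shape.
Local Notation multi_index := {ffun 'I_d -> 'I_p.+1}.
Implicit Types (g : 'cV[R]_d -> R).

Definition bb_spanned g :=
  exists c : multi_index -> R,
    forall x, g x = \sum_(m in bb_index d U p) c m * bernstein U m x.

Lemma bb_spanned_sum (I : Type) (r : seq I) (P : pred I)
    (g : I -> 'cV[R]_d -> R) :
  (forall i, P i -> bb_spanned (g i)) ->
  bb_spanned (fun x => \sum_(i <- r | P i) g i x).
Proof.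
move=> gs; elim: r => [|i r [c cE]].
  by exists (fun=> 0) => x; rewrite big_nil big1// => m _; rewrite mul0r.
have [Pi|nPi] := boolP (P i); last first.
  by exists c => x; rewrite big_cons (negPf nPi).
have [b bE] := gs i Pi; exists (fun m => b m + c m) => x.
rewrite big_cons Pi bE cE -big_split/=.
by apply: eq_bigr => m _; rewrite mulrDl.
Qed.

Lemma bb_spannedD g1 g2 : bb_spanned g1 -> bb_spanned g2 ->
  bb_spanned (fun x => g1 x + g2 x).
Proof.
move=> [b bE] [c cE]; exists (fun m => b m + c m) => x.
by rewrite bE cE -big_split/=; apply: eq_bigr => m _; rewrite mulrDl.
Qed.

Lemma bb_spannedZ a g : bb_spanned g -> bb_spanned (fun x => a * g x).
Proof.
move=> [c cE]; exists (fun m => a * c m) => x.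
by rewrite cE mulr_sumr; apply: eq_bigr => m _; rewrite mulrA.
Qed.

Lemma bb_spanned_bernstein (m : multi_index) :
  m \in bb_index d U p -> bb_spanned (bernstein U m).
Proof.
move=> mU; exists (fun m' => (m' == m)%:R) => x.
rewrite (bigD1 m)//= eqxx mul1r big1 ?addr0// => m' /andP[_ /negPf->].
by rewrite mul0r.
Qed.

Lemma eq_bb_spanned g1 g2 : g1 =1 g2 -> bb_spanned g1 -> bb_spanned g2.
Proof. by move=> /funext ->. Qed.

End Span.

Section Monomials.
Context {R : realType} {d p : nat}.
Local Notation multi_index := {ffun 'I_d -> 'I_p.+1}.

(* A factor of deficient degree is raised by inserting 1 = x_l + (1 - x_l). *)
Lemma bb_spanned_cube (a b : 'I_d -> nat) : (forall k, (a k + b k <= p)%N) ->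
  bb_spanned (p := p) Cube
    (fun x : 'cV[R]_d => \prod_k (x k 0 ^+ a k * (1 - x k 0) ^+ b k)).
Proof.
have [n] := ubnP (\sum_k (p - (a k + b k))).
elim: n a b => // n ih a b nab abp.
(* When no coordinate is deficient, b_k = p - a_k and the product is a Bernstein polynomial up to
   binomial factors. *)
have [l lab|full] := pickP (fun l => a l + b l < p)%N; last first.
  have bE k : b k = (p - a k)%N.
    have := full k; have := abp k; rewrite leq_eqVlt => /predU1P[<-|->//].
    by rewrite addKn.
  have alep k : (a k <= p)%N by rewrite (leq_trans _ (abp k))// leq_addr.
  pose m : multi_index := [ffun k => inord (a k)].
  have mE k : m k = a k :> nat by rewrite ffunE inordK// ltnS.
  have mU : m \in bb_index d Cube p by rewrite inE.
  apply: (eq_bb_spanned _ (bb_spannedZ (\prod_k 'C(p, a k)%:R)^-1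
    (@bb_spanned_bernstein R d p Cube m mU))) => x /=.
  rewrite -prodfV -big_split/=; apply: eq_bigr => k _.
  rewrite mE bE !mulrA mulVf ?mul1r 1?mulrC//.
  by rewrite pnatr_eq0 -lt0n bin_gt0.
have n_gt : (\sum_k (p - (a k + b k + (k == l))) < n)%N.
  rewrite -ltnS (leq_trans _ nab)// ltnS [ltnRHS](bigD1 l)//= (bigD1 l)//= eqxx.
  rewrite -addSn leq_add//; first by rewrite addn1 -subSn// subSS.
  by apply: leq_sum => k _; rewrite leq_sub2l// leq_addr.
have le k : (a k + b k + (k == l) <= p)%N.
  by have [->|_] := eqVneq; rewrite ?addn1 ?addn0.
apply: (eq_bb_spanned _ (bb_spannedD
  (ih (fun k => a k + (k == l))%N b _ _)
  (ih a (fun k => b k + (k == l))%N _ _))) => [x||k||k].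
- rewrite -[RHS]mul1r -[X in _ = X * _](subrK (x l 0)) mulrDl addrC.
  by rewrite -[1 - x l 0](prod_delta l (fun k => 1 - x k 0))
    -[x l 0](prod_delta l (fun k => x k 0)) -!big_split/=;
    congr (_ + _); apply: eq_bigr => k _; rewrite exprD; ring.
- by under eq_bigr do rewrite addnAC.
- by rewrite addnAC.
- by under eq_bigr do rewrite addnA.
- by rewrite addnA.
Qed.

(** Multiplying by 1 = (sum of the x_k) + (1 - sum of the x_k) raises the total degree by one in
    every resulting term, so the deficiency p - (|a| + b) decreases to 0, where a Bernstein
    polynomial appears up to its multinomial coefficient. *)
Lemma bb_spanned_simplex (a : 'I_d -> nat) (b : nat) : (\sum_k a k + b <= p)%N ->
  bb_spanned (p := p) Simplex
    (fun x : 'cV[R]_d => (\prod_k x k 0 ^+ a k) * (1 - \sum_k x k 0) ^+ b).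
Proof.
have [n] := ubnP (p - (\sum_k a k + b)).
elim: n a b => // n ih a b nab abp.
have [full|lt] := leqP p (\sum_k a k + b)%N.
  have {abp full} abp : (\sum_k a k + b)%N = p by apply/eqP; rewrite eqn_leq abp.
  have alep k : (a k <= p)%N by rewrite -abp (bigD1 k)//= -addnA leq_addr.
  pose m : multi_index := [ffun k => inord (a k)].
  have mE k : m k = a k :> nat by rewrite ffunE inordK// ltnS.
  have sm : (\sum_k m k = \sum_k a k)%N by apply: eq_bigr => k _; rewrite mE.
  have mU : m \in bb_index d Simplex p by rewrite inE sm -abp leq_addr.
  apply: (eq_bb_spanned _ (bb_spannedZ
    (p`!%:R / ((\prod_k (m k)`!) * (p - \sum_k m k)`!)%N%:R)^-1
    (@bb_spanned_bernstein R d p Simplex m mU))) => x /=.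
  rewrite -mulrA mulKf; last first.
    rewrite mulf_neq0 ?invr_eq0// pnatr_eq0 -lt0n ?muln_gt0 ?fact_gt0 ?prodn_gt0//.
    by move=> k; exact: fact_gt0.
  rewrite sm (_ : p - \sum_k a k = b)%N; last by rewrite -[in LHS]abp addKn.
  congr (_ * _).
  by apply: eq_bigr => k _; rewrite mE.
have n_gt : (p - (\sum_k a k + b).+1 < n)%N.
  by rewrite -ltnS (leq_trans _ nab)// ltnS -subSn// subSS.
apply: (eq_bb_spanned _ (bb_spannedD (ih a b.+1 _ _)
  (bb_spanned_sum (index_enum _) (fun l _ =>
    ih (fun k => a k + (k == l))%N b _ _)))) => [x|||l _|l _].
- rewrite -[RHS]mul1r -[X in _ = X * _](subrK (\sum_k x k 0)) mulrDl exprSr.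
  congr (_ + _); first by ring.
  rewrite mulr_suml; apply: eq_bigr => l _.
  rewrite mulrA -[x l 0](prod_delta l (fun k => x k 0)) -big_split/=.
  by congr (_ * _); apply: eq_bigr => k _; rewrite exprD mulrC.
- by rewrite addnS.
- by rewrite addnS.
- by rewrite (sum_delta l a) addSn.
- by rewrite (sum_delta l a) addSn.
Qed.

End Monomials.

(** Monomials are the case without complementary factors of the two spanning lemmas, so each
    coordinate of [F] is spanned. This existence ensures that [control_points] represents [F]
    instead of taking its default value 0. *)
Lemma polynomial_map_bb_form (R : realType) (d p : nat) (U : domain_shape)
    (F : 'cV[R]_d -> 'cV[R]_d) : polynomial_map U p F ->
  exists f : {ffun 'I_d -> 'I_p.+1} -> 'cV[R]_d, forall x, F x = bb_form U f x.
Proof.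
move=> [P [Pdeg FE]].
have monomial i (a : mpoly.multinom d) : a \in mpoly.msupp (P i) -> bb_spanned (p := p) U
    (fun x : 'cV[R]_d => \prod_k x k 0 ^+ a k).
  move=> aP; case: U Pdeg => [/(_ i a aP)|/(_ i)] ap.
    apply: (eq_bb_spanned _ (@bb_spanned_cube R d p _ (fun=> 0%N) _)) => [x|k].
      by apply: eq_bigr => k _; rewrite expr0 mulr1.
    by rewrite addn0 ap.
  apply: (eq_bb_spanned _ (@bb_spanned_simplex R d p _ 0%N _)) => [x|].
    by rewrite expr0 mulr1.
  rewrite addn0 -mpoly.mdegE -ltnS.
  exact: leq_trans (mpoly.msize_mdeg_lt aP) ap.
have /choice[c cE] i : bb_spanned (p := p) U (fun x => F x i 0).
  apply: (eq_bb_spanned _ (bb_spanned_sum (mpoly.msupp (P i))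
    (P := fun a => a \in mpoly.msupp (P i))
    (g := fun (a : mpoly.multinom d) x =>
      mpoly.mcoeff a (P i) * \prod_k x k 0 ^+ a k) _)).
    by move=> x; rewrite FE mpoly.mevalE [RHS]big_seq.
  by move=> a /monomial; exact: bb_spannedZ.
exists (fun m => \col_i c i m) => x; apply/colP => i.
rewrite cE /bb_form summxE; apply: eq_bigr => m _.
by rewrite !mxE mulrC.
Qed.

(** * Invertibility of the derivative matrix *)

Lemma of_columns_scale (R : realType) (d : nat) (a : 'I_d -> R)
    (u : 'I_d -> 'cV[R]_d) :
  of_columns (fun l => a l *: u l) = of_columns u *m diag_mx (\row_l a l).
Proof. by apply/matrixP => i j; rewrite mul_mx_diag !mxE mulrC. Qed.

Theorem theorem2 (R : realType) (d : nat) (hd : d = 2%N \/ d = 3%N)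
    (U : domain_shape) (p : nat) (hp : (1 <= p)%N)
    (F : 'cV[R]_d -> 'cV[R]_d) (hF : polynomial_map U p F)
    (hG : forall u : 'I_d -> 'cV[R]_d,
      (forall l : 'I_d, hull (partial_control_points U p F l) (u l)) ->
      of_columns u \in unitmx) :
  forall x : 'cV[R]_d, domain_set U x -> derivative_matrix F x \in unitmx.
Proof.
move=> x xU.
pose f : {ffun 'I_d -> 'I_p.+1} -> 'cV[R]_d := control_points U F.
have FE : F = bb_form U f.
  by apply/funext; exact: (xgetPex (fun=> 0) (polynomial_map_bb_form hF)).
(* The division by p compensates the factor p built into the control points [v mm] of the partial
   derivatives. *)
pose w l (mm : {ffun 'I_d -> 'I_p.+1} * {ffun 'I_d -> 'I_p.+1}) : R :=
  line_weight U l mm.1 x / p%:R.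
pose W l := \sum_(mm | succ_pair U l mm) w l mm.
pose v (mm : {ffun 'I_d -> 'I_p.+1} * {ffun 'I_d -> 'I_p.+1}) :=
  p%:R *: (f mm.2 - f mm.1).
have w0 l mm : 0 <= w l mm by rewrite divr_ge0// line_weight_ge0.
have W0 l : 0 < W l.
  have [mm mmU wmm] := line_weight_gt0 l hp xU.
  rewrite /W (bigD1 mm)//= ltr_wpDr ?sumr_ge0//.
  by rewrite divr_gt0// ltr0n.
pose u l := (W l)^-1 *: \sum_(mm | succ_pair U l mm) w l mm *: v mm.
have DE : derivative_matrix F x = of_columns (fun l => W l *: u l).
  congr of_columns; apply/funext => l; rewrite FE derive_bb_form.
  rewrite scalerA divff ?gt_eqF// scale1r; apply: eq_bigr => mm _.
  by rewrite scalerA divfK// pnatr_eq0 -lt0n.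
(* The matrix with columns [u l] is invertible by [hG], and the diagonal factor has the positive
   entries [W l]. *)
rewrite DE of_columns_scale unitmx_mul; apply/andP; split.
  apply: hG => l; apply: hull_barycenter => [//|mm mmU|]; last exact: W0.
  by apply: hull_mem; exact: (fintype.image_f _ mmU).
rewrite unitmxE det_diag unitfE; apply/prodf_neq0 => l _.
by rewrite mxE gt_eqF.
Qed.
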